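(* Fix a measurable set $\mathcal{S}\subset\mathbb{R}_{\geq 0}$ with positive Lebesgue measure. Consider the model in which $\mu\sim G$ for a probability distribution $G$ on $\mathbb{R}$, $|Z|\mid\mu\sim|\mathrm{N}(\mu,1)|$, and $D\mid(|Z|,\mu)\sim\mathrm{Bernoulli}(\pi(|Z|))$ for a measurable $\pi:\mathbb{R}_{\ge0}\to[0,1]$, and suppose that the conditional distribution of $|Z|$ given $\{|Z|\in\mathcal{S},D=1\}$ equals the conditional distribution of $|Z|$ given $\{|Z|\in\mathcal{S}\}$. Then $\mathrm{Fold}[G]$ (equivalently $\mathrm{Symm}[G]$) is identified from the distribution of the observed absolute z-scores, i.e. from the conditional law of $|Z|$ given $D=1$: if $(G,\pi)$ and $(H,\pi')$ both satisfy these assumptions (with the same $\mathcal{S}$) and induce the same conditional law of $|Z|$ given $D=1$, then $\mathrm{Fold}[G]=\mathrm{Fold}[H]$.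
   Context: $|\mathrm{N}(\mu,1)|$ is the folded normal distribution (law of $|X|$, $X\sim \mathrm{N}(\mu,1)$). For a distribution $G$ on $\mathbb{R}$, the symmetrized distribution is $\mathrm{Symm}[G](A)=\{G(A)+G(-A)\}/2$ for Borel $A$, and the folded distribution $\mathrm{Fold}[G]$ is the distribution on $[0,\infty)$ with $\mathrm{Fold}[G](A)=G(A)+G(-A)$ for Borel $A\subset[0,\infty)$ and $\mathrm{Fold}[G]((-\infty,0))=0$; i.e. $\mathrm{Fold}[G]$ is the law of $|\mu|$ for $\mu\sim G$. Only $|Z|$ with $D=1$ is observed. *)

(* Defs.v *)
From HB Require Import structures.
From mathcomp Require Import all_boot all_order all_algebra.
From mathcomp Require Import all_classical all_reals all_analysis.
Set Implicit Arguments. Unset Strict Implicit. Unset Printing Implicit Defensive.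
Import Order.TTheory GRing.Theory Num.Theory.
Local Open Scope classical_set_scope.
Local Open Scope ring_scope.

Section model.
Context {R : realType}.

Definition nonneg : set R := [set z | 0 <= z].

Definition folded_normal_pdf (mu z : R) : R :=
  normal_pdf mu 1 z + normal_pdf mu 1 (- z).

(* P(|Z| \in A, D = 1) in the model mu ~ G, |Z| | mu ~ |N(mu,1)|,
   D | (|Z|, mu) ~ Bernoulli(pi |Z|). *)
Definition sel_mass (G : probability R R) (pi : R -> R) (A : set R) : \bar R :=
  (\int[G]_mu
     \int[@lebesgue_measure R]_(z in A `&` nonneg)
        ((pi z) * folded_normal_pdf mu z)%:E)%E.

Definition abs_mass (G : probability R R) (A : set R) : \bar R :=
  sel_mass G (fun _ => 1) A.

Definition obs_law (G : probability R R) (pi : R -> R) (A : set R) : R :=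
  fine (sel_mass G pi A) / fine (sel_mass G pi setT).

Definition model_assumptions (S : set R) (G : probability R R) (pi : R -> R) : Prop :=
  [/\ measurable_fun nonneg pi,
      (forall z, 0 <= z -> 0 <= pi z <= 1),
      (* P(D = 1) > 0, so the observed law is defined *)
      (0 < sel_mass G pi setT)%E,
      (* P(|Z| \in S, D = 1) > 0, so the conditional law is defined *)
      (0 < sel_mass G pi S)%E &
      forall A, measurable A ->
        fine (sel_mass G pi (A `&` S)) / fine (sel_mass G pi S)
        = fine (abs_mass G (A `&` S)) / fine (abs_mass G S)].

Definition Fold (G : probability R R) (A : set R) : \bar R :=
  G ((fun x : R => `|x|) @^-1` A).

End model.

(* Main.v *)
Require Import Defs.
From HB Require Import structures.
From mathcomp Require Import all_boot all_order all_algebra.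
From mathcomp Require Import all_classical all_reals all_analysis.
From mathcomp Require Import measurable_realfun.
From mathcomp Require Import ring lra.
Import Order.TTheory GRing.Theory Num.Theory.
Import numFieldNormedType.Exports.
Local Open Scope classical_set_scope.
Local Open Scope ring_scope.
Set Implicit Arguments. Unset Strict Implicit. Unset Printing Implicit Defensive.

(* The folded normal density factors as
     phi(z - mu) + phi(z + mu) = w(z) e^{-mu^2/2} (e^{z mu} + e^{-z mu}),  w > 0.
   The assumptions force the densities of |Z| under G and H to be proportional
   on S, so the entire functions z |-> E[e^{-mu^2/2} (e^{z mu} + e^{-z mu})]
   attached to G and H agree up to a constant c almost everywhere on S, which
   has an accumulation point; hence they agree up to c everywhere and so do the
   Taylor coefficients at 0, the moments E[e^{-mu^2/2} mu^{2k}].  Re-expanding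
   e^{-l mu^2} around successive points propagates this to every l > 0, and l = 0
   gives c = 1: the laws of mu^2 under G and H have the same Laplace transform. *)

(** * Identity theorem for real power series *)

(** Inside the radius of convergence, the terms of positive degree add up to O(|t|) uniformly over
    partial sums. At a zero t of the series this bounds |a 0| by a multiple of |t|, and t can be
    taken arbitrarily small. *)
Lemma series_const_coef0 (R : realType) (a : R^nat) (r : R) :
  0 < r -> cvgn (pseries a r) ->
  (forall e : R, 0 < e ->
    exists2 t, 0 < `|t| < e & pseries a t @ \oo --> (0 : R)) ->
  a 0%N = 0.
Proof.
move=> r0 car az.
pose s := r / 2.
have s0 : 0 < s by rewrite divr_gt0.
have cs : cvgn (pseries (fun i => `|a i|) s).
  apply: is_cvg_pseries_inside_norm car _.
  rewrite !gtr0_norm// /s; lra.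
pose C := limn (pseries (fun i => `|a i|) s).
have Cub n : pseries (fun i => `|a i|) s n <= C.
  apply: nondecreasing_cvgn_le => //.
  apply: nondecreasing_series => k _ _.
  by rewrite mulr_ge0// exprn_ge0// ltW.
have C0 : 0 <= C by apply: le_trans (Cub 0%N); rewrite /pseries/series/= big_nil.
apply/eqP; rewrite -normr_le0; apply/ler_addgt0Pr => e e0; rewrite add0r.
(* The bound [s] keeps |t| / s at most 1, so its powers of degree at least 1 are at most |t| / s.
   The second bound makes |t| / s * C at most e, with C + 1 in place of C in case C is 0. *)
have [t /andP[t0 te] tz] :
    exists2 t, 0 < `|t| < Num.min s (e * s / (C + 1)) & pseries a t @ \oo --> (0 : R).
  by apply: az; rewrite lt_min s0 divr_gt0 ?mulr_gt0// ltr_wpDl.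
move: te; rewrite lt_min => /andP[ts te].
have q1 : `|t| / s <= 1 by rewrite ler_pdivrMr// mul1r ltW.
have q0 : 0 <= `|t| / s by rewrite divr_ge0// ltW.
have bnd n : `|a 0%N| - `|t| / s * C <= `|pseries a t n.+1|.
  rewrite /pseries /series/= big_nat_recl//= expr0 mulr1.
  apply: le_trans (lerB_normD _ _); rewrite lerD2l lerN2.
  apply: le_trans (ler_norm_sum _ _ _) _.
  apply: (@le_trans _ _ (`|t| / s * pseries (fun i => `|a i|) s n.+1)).
    rewrite /pseries /series/= big_nat_recl//= expr0 mulr1 mulrDr.
    apply: ler_wpDl; first exact: mulr_ge0.
    rewrite mulr_sumr; apply: ler_sum => k _.
    rewrite normrM normrX.
    have -> : `|t| = `|t| / s * s by rewrite divfK// gt_eqF.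
    rewrite exprMn mulfK ?gt_eqF// mulrCA ler_wpM2r//; last first.
      by rewrite exprS ler_piMr// exprn_ile1.
    by rewrite mulr_ge0// exprn_ge0// ltW.
  exact: ler_wpM2l.
have lim0 : `|a 0%N| - `|t| / s * C <= 0.
  rewrite -(normr0 R); apply: (@ler_cvg_to _ \oo _ _ (cst (`|a 0%N| - `|t| / s * C))
    (fun n => `|pseries a t n.+1|)).
  - exact: cvg_cst.
  - apply: cvg_norm; move: tz; rewrite -(cvg_shiftS (pseries a t)); exact.
  - exact: nearW.
rewrite subr_le0 in lim0; apply: (le_trans lim0).
move: te; rewrite ltr_pdivlMr ?ltr_wpDl// => te.
rewrite mulrAC ler_pdivrMr// (le_trans _ (ltW te))//.
by rewrite ler_wpM2l// lerDl.
Qed.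

(** Induction on the degree: once [a 0] is 0, dividing by t yields the series of shifted
    coefficients, which vanishes at the same nonzero points. *)
Lemma pseries_eq0 (R : realType) (a : R^nat) (r : R) :
  0 < r -> cvgn (pseries a r) ->
  (forall e : R, 0 < e ->
    exists2 t, 0 < `|t| < e & pseries a t @ \oo --> (0 : R)) ->
  forall k, a k = 0.
Proof.
move=> r0 + + k; elim: k a => [|k IH] a car az; first exact: series_const_coef0 car az.
have a0 := series_const_coef0 r0 car az.
have shiftE (t : R) n : t != 0 ->
    pseries (fun i => a i.+1) t n = t^-1 * pseries a t n.+1.
  move=> t0; rewrite /pseries /series/= big_nat_recl//= a0 mul0r add0r mulr_sumr.
  by apply: eq_bigr => i _; rewrite exprS mulrCA mulKf.
have shift_cvg (t l : R) : t != 0 -> pseries a t @ \oo --> l ->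
    pseries (fun i => a i.+1) t @ \oo --> t^-1 * l.
  move=> t0 tl.
  have -> : pseries (fun i => a i.+1) t = (fun n => t^-1 * pseries a t n.+1).
    by apply/funext => n; exact: shiftE.
  by apply: cvgMr; move: tl; rewrite -(cvg_shiftS (pseries a t)).
apply: (IH (fun i => a i.+1)) => [|e /az[t /andP[t0 te] tz]].
  by apply/cvg_ex; exists (r^-1 * limn (pseries a r)); apply: shift_cvg; rewrite // gt_eqF.
exists t; first by rewrite t0.
by rewrite -(mulr0 t^-1); apply: shift_cvg; rewrite -?normr_gt0.
Qed.

(** * Bounded expectations and termwise integration of exponential series *)

Section bounded_expectation.
Context d (T : measurableType d) (R : realType) (P : probability T R).
Implicit Types (f g h : T -> R) (M r t : R).

Lemma bounded_integrable f M : measurable_fun setT f ->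
  (forall x, `|f x| <= M) -> P.-integrable setT (EFin \o f).
Proof.
move=> mf fM; apply: measurable_bounded_integrable => //.
  by rewrite -ge0_fin_numE//; exact: fin_num_measure.
exists M; split; first exact: num_real.
by move=> N MN x _; exact: le_trans (fM x) (ltW MN).
Qed.

Lemma bounded_Rintegral_cvg (f_ : nat -> T -> R) f M :
  (forall n, measurable_fun setT (f_ n)) -> measurable_fun setT f ->
  (forall n x, `|f_ n x| <= M) ->
  (forall x, f_ n x @[n --> \oo] --> f x) ->
  \int[P]_x f_ n x @[n --> \oo] --> \int[P]_x f x.
Proof.
move=> mf_ mf f_M f_f.
have [] // := @dominated_convergence _ _ _ P _ measurableT
  (fun n => EFin \o f_ n) (EFin \o f) (EFin \o cst M).
- by move=> n; exact/measurable_EFinP.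
- exact/measurable_EFinP.
- by apply: aeW => x _; apply: cvg_EFin; [exact: nearW|exact: f_f].
- by apply: (@bounded_integrable (cst M) `|M|).
- by apply: aeW => x n _; rewrite lee_fin.
move=> fi _ cv; apply: fine_cvg; rewrite fineK//.
exact: integrable_fin_num.
Qed.

Lemma Rintegral_series (u : nat -> T -> R) n :
  (forall k, P.-integrable setT (EFin \o u k)) ->
  \int[P]_x series (u ^~ x) n = series (fun k => \int[P]_x u k x) n.
Proof.
move=> iu.
(* Integrability of the partial sums goes through the same induction, because additivity of the
   integral requires it at each step. *)
suff h : P.-integrable setT (EFin \o (fun x => series (u ^~ x) n)) /\
  \int[P]_x series (u ^~ x) n = series (fun k => \int[P]_x u k x) n by case: h.
elim: n => [|n [ii IH]].
  have -> : (fun x => series (u ^~ x) 0) = cst 0.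
    by apply/funext => x; rewrite /series/= big_nil.
  split; first by apply: (@bounded_integrable (cst 0) 0) => // x; rewrite normr0.
  by rewrite Rintegral_cst// mul0r /series/= big_nil.
have -> : (fun x => series (u ^~ x) n.+1) = (fun x => series (u ^~ x) n + u n x).
  by apply/funext => x; rewrite /series/= big_nat_recr.
split.
  rewrite [X in P.-integrable _ X](_ : _ = (EFin \o (fun x => series (u ^~ x) n)) \+ (EFin \o u n))%E//.
  exact: integrableD.
by rewrite RintegralD// IH /series/= big_nat_recr.
Qed.

Lemma normr_series_exp_coeff (y : R) n : `|series (exp_coeff y) n| <= expR `|y|.
Proof.
apply: (@le_trans _ _ (series (exp_coeff `|y|) n)).
  apply: le_trans (ler_norm_sum _ _ _) _; apply: ler_sum => k _.
  by rewrite /exp_coeff/= normrM normrX normfV normr_nat.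
apply: nondecreasing_cvgn_le; last exact: is_cvg_series_exp_coeff.
by apply: nondecreasing_series => k _ _; exact: exp_coeff_ge0.
Qed.

Lemma exp_coeff_le_expR (y : R) n : 0 <= y -> exp_coeff y n <= expR y.
Proof.
move=> y0; apply: (@le_trans _ _ (series (exp_coeff y) n.+1)).
  rewrite /series/= big_nat_recr//= lerDr sumr_ge0// => i _.
  exact: exp_coeff_ge0.
by apply: le_trans (ler_norm _) _; rewrite -{2}(ger0_norm y0); exact: normr_series_exp_coeff.
Qed.

(** A single term of the exponential series gives (r |h|)^n / n! <= e^{r |h|}. *)
Lemma moment_bounded g h r M n : 0 < r ->
  (forall x, `|g x| * expR (r * `|h x|) <= M) ->
  forall x, `|g x * h x ^+ n| <= M * (n`!%:R / r ^+ n).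
Proof.
move=> r0 ghM x.
have /(exp_coeff_le_expR n) : 0 <= r * `|h x| by rewrite mulr_ge0// ltW.
rewrite /exp_coeff/= exprMn => le1.
have k0 : 0 < n`!%:R / r ^+ n :> R.
  by rewrite divr_gt0 ?exprn_gt0// ltr0n fact_gt0.
rewrite normrM normrX -ler_pdivrMr//; apply: le_trans (ghM x).
rewrite -mulrA ler_wpM2l//; apply: le_trans le1.
by rewrite invf_div mulrA [X in _ <= X / _]mulrC.
Qed.

(** The partial sums of g e^{t h} are dominated by |g| e^{|t h|} <= M, so dominated convergence
    exchanges sum and expectation. The boundary case |t| = r is included; it later gives access to
    the Laplace parameter 0. *)
Lemma expR_moment_series g h r M t :
  measurable_fun setT g -> measurable_fun setT h -> 0 < r ->
  (forall x, `|g x| * expR (r * `|h x|) <= M) -> `|t| <= r ->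
  pseries (fun k => (\int[P]_x (g x * h x ^+ k)) / k`!%:R) t @ \oo -->
  \int[P]_x (g x * expR (t * h x)).
Proof.
move=> mg mh r0 ghM tr.
pose u k x := g x * exp_coeff (t * h x) k.
have uE k : u k = (fun x => (t ^+ k / k`!%:R) * (g x * h x ^+ k)).
  by apply/funext => x; rewrite /u /exp_coeff/= exprMn; ring.
have mghn k : measurable_fun setT (fun x => g x * h x ^+ k).
  by apply: measurable_funM => //; exact: measurable_funX.
have ighn k : P.-integrable setT (EFin \o (fun x => g x * h x ^+ k)).
  by apply: bounded_integrable => //; exact: moment_bounded r0 ghM.
have iu k : P.-integrable setT (EFin \o u k).
  rewrite uE.
  rewrite [X in P.-integrable _ X](_ : _ =
     (fun x => (t ^+ k / k`!%:R)%:E * (EFin \o (fun y => g y * h y ^+ k)%R) x)%E)//.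
  exact: integrableZl.
have uS n x : series (u ^~ x) n = g x * series (exp_coeff (t * h x)) n.
  by rewrite /series/= mulr_sumr.
have -> : pseries (fun k => (\int[P]_x (g x * h x ^+ k)) / k`!%:R) t =
          (fun n => \int[P]_x series (u ^~ x) n).
  apply/funext => n; rewrite Rintegral_series// /pseries /series/=.
  apply: eq_bigr => k _; rewrite uE RintegralZl//; ring.
apply: (@bounded_Rintegral_cvg _ _ M).
- move=> n; rewrite /series/=; apply: measurable_sum => k.
  by rewrite uE; apply: measurable_funM.
- apply: measurable_funM => //; apply: measurableT_comp => //.
  exact: measurable_funM.
- move=> n x; rewrite uS normrM; apply: le_trans (ghM x).
  rewrite ler_wpM2l// (le_trans (normr_series_exp_coeff _ _))// ler_expR normrM.
  by rewrite ler_wpM2r.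
- move=> x; have -> : series (u ^~ x) = (fun n => g x * series (exp_coeff (t * h x)) n).
    by apply/funext.
  by apply: cvgMr; exact: is_cvg_series_exp_coeff.
Qed.

End bounded_expectation.

(** * The entire function attached to a prior *)

Section cosh_transform.
Context {R : realType}.
Implicit Types (P G H : probability R R) (z t c r mu : R).

Definition cosh_kernel (z mu : R) : R :=
  expR (- (mu ^+ 2 / 2)) * (expR (z * mu) + expR (- (z * mu))).

Definition cosh_transform P z : R := \int[P]_mu cosh_kernel z mu.

Definition gauss_tilt (z mu : R) : R := expR (- (mu ^+ 2 / 2) + z * mu).

(** Taylor coefficients of [cosh_transform P] at z, one summand for each of the two exponentials. *)
Let cosh_coef P z k : R :=
  (\int[P]_mu (gauss_tilt z mu * mu ^+ k)) / k`!%:R +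
  (\int[P]_mu (gauss_tilt (- z) mu * (- mu) ^+ k)) / k`!%:R.

Let measurable_gauss_tilt z : measurable_fun setT (gauss_tilt z).
Proof.
apply: measurableT_comp => //; apply: measurable_funD.
  apply: measurableT_comp => //; apply: measurable_funM => //.
exact: measurable_funM.
Qed.

(** Completing the square in |mu|: the Gaussian factor absorbs an exponential of any rate r, which
    makes all radii of convergence infinite. *)
Let tilt_bound z r mu : 0 < r ->
  `|gauss_tilt z mu| * expR (r * `|mu|) <= expR ((`|z| + r) ^+ 2 / 2).
Proof.
move=> r0; rewrite /gauss_tilt ger0_norm ?expR_ge0// -expRD ler_expR.
have zm : z * mu <= `|z| * `|mu| by rewrite -normrM ler_norm.
have : 0 <= (`|mu| - (`|z| + r)) ^+ 2 by exact: sqr_ge0.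
have -> : mu ^+ 2 = `|mu| ^+ 2 by rewrite real_normK ?num_real.
nra.
Qed.

Let tilt_bound_id z r : 0 < r ->
  forall mu, `|gauss_tilt z mu| * expR (r * `|idfun mu|) <= expR ((`|z| + r) ^+ 2 / 2).
Proof. by move=> r0 mu; exact: tilt_bound. Qed.

Let tilt_bound_opp z r : 0 < r ->
  forall mu, `|gauss_tilt z mu| * expR (r * `|- mu|) <= expR ((`|z| + r) ^+ 2 / 2).
Proof. by move=> r0 mu; rewrite normrN; exact: tilt_bound. Qed.

Lemma integrable_gauss_tilt P z : P.-integrable setT (EFin \o gauss_tilt z).
Proof.
apply: (@bounded_integrable _ _ _ _ _ (expR ((`|z| + 1) ^+ 2 / 2))) => // mu.
apply: le_trans (tilt_bound z mu ltr01).
by rewrite ler_peMr// -expR0 ler_expR mulr_ge0.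
Qed.

Let cosh_kernelE z mu : cosh_kernel z mu = gauss_tilt z mu + gauss_tilt (- z) mu.
Proof. by rewrite /cosh_kernel /gauss_tilt mulrDr -!expRD mulNr. Qed.

Lemma cosh_transformE P z : cosh_transform P z =
  \int[P]_mu gauss_tilt z mu + \int[P]_mu gauss_tilt (- z) mu.
Proof.
rewrite -RintegralD//; try exact: integrable_gauss_tilt.
by apply: eq_Rintegral => mu _; rewrite cosh_kernelE.
Qed.

(** Moving the centre by t multiplies the tilt at z by e^{t mu} and the tilt at -z by e^{-t mu}, so
    [expR_moment_series] applies with h = mu and with h = -mu. *)
Let cosh_transform_series P z t :
  pseries (cosh_coef P z) t @ \oo --> cosh_transform P (z + t).
Proof.
have r0 : 0 < `|t| + 1 by rewrite ltr_wpDl.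
have tr : `|t| <= `|t| + 1 by rewrite lerDl.
have -> : pseries (cosh_coef P z) t =
    pseries (fun k => (\int[P]_mu (gauss_tilt z mu * idfun mu ^+ k)) / k`!%:R) t +
    pseries (fun k => (\int[P]_mu (gauss_tilt (- z) mu * (- mu) ^+ k)) / k`!%:R) t.
  apply/funext => n; rewrite /pseries fctE /series/= -big_split/=.
  by apply: eq_bigr => k _; rewrite -mulrDl.
rewrite cosh_transformE.
rewrite (_ : \int[P]_mu gauss_tilt (z + t) mu =
             \int[P]_mu (gauss_tilt z mu * expR (t * idfun mu))); last first.
  by apply: eq_Rintegral => mu _; rewrite /gauss_tilt -expRD/=; congr expR; ring.
rewrite (_ : \int[P]_mu gauss_tilt (- (z + t)) mu =
             \int[P]_mu (gauss_tilt (- z) mu * expR (t * - mu))); last first.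
  by apply: eq_Rintegral => mu _; rewrite /gauss_tilt -expRD/=; congr expR; ring.
apply: cvgD.
  exact: (expR_moment_series (measurable_gauss_tilt z) (@measurable_id _ _ _)
    r0 (tilt_bound_id z r0) tr).
by apply: (expR_moment_series (measurable_gauss_tilt (- z)) _
  r0 (tilt_bound_opp (- z) r0) tr).
Qed.

Let cosh_diff_series G H c z t :
  pseries (fun k => cosh_coef G z k - c * cosh_coef H z k) t @ \oo -->
  cosh_transform G (z + t) - c * cosh_transform H (z + t).
Proof.
have -> : pseries (fun k => cosh_coef G z k - c * cosh_coef H z k) t =
    (fun n => pseries (cosh_coef G z) t n - c * pseries (cosh_coef H z) t n).
  apply/funext => n; rewrite /pseries /series/= mulr_sumr -sumrB.
  by apply: eq_bigr => k _; ring.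
by apply: cvgB; [|apply: cvgMr]; exact: cosh_transform_series.
Qed.

Let cosh_coef_eq G H c z :
  (forall e : R, 0 < e -> exists2 t, 0 < `|t| < e &
     cosh_transform G (z + t) = c * cosh_transform H (z + t)) ->
  forall k, cosh_coef G z k = c * cosh_coef H z k.
Proof.
move=> zeros k; apply/eqP; rewrite -subr_eq0; apply/eqP; move: k.
apply: (@pseries_eq0 _ _ 1) => //.
  by apply/cvg_ex; eexists; exact: cosh_diff_series.
move=> e /zeros[t te GHt]; exists t => //.
have := @cosh_diff_series G H c z t; rewrite GHt subrr; exact.
Qed.

(** The identity theorem at [z0] equates all Taylor coefficients there up to c. Since the expansion
    at [z0] converges everywhere, this single centre reaches every z. *)
Lemma cosh_transform_ext G H c (Z : set R) z0 : limit_point Z z0 ->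
  (forall z, Z z -> cosh_transform G z = c * cosh_transform H z) ->
  forall z, cosh_transform G z = c * cosh_transform H z.
Proof.
move=> Zz0 GH z.
have coefE : forall k, cosh_coef G z0 k = c * cosh_coef H z0 k.
  apply: cosh_coef_eq => e e0.
  have [|y [yz0 Zy]] := Zz0 (ball z0 e); first exact: nbhsx_ballx.
  rewrite /ball/= => yb; exists (y - z0); last by rewrite addrC subrK; exact: GH.
  by rewrite normr_gt0 subr_eq0 yz0/= distrC.
have := @cosh_diff_series G H c z0 (z - z0).
rewrite (_ : (fun k => _) = cst 0); last by apply/funext => k; rewrite coefE subrr.
rewrite (_ : pseries _ _ = cst 0); last first.
  by apply/funext => n; rewrite /pseries /series/= big1// => i _; rewrite mul0r.
have -> : z0 + (z - z0) = z by ring.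
move=> lim0; apply/eqP; rewrite -subr_eq0; apply/eqP.
exact: (cvg_unique _ lim0 (cvg_cst 0)).
Qed.

(** These are the even Taylor coefficients at 0, where the two exponentials contribute equally. *)
Lemma cosh_transform_moments G H c :
  (forall z, cosh_transform G z = c * cosh_transform H z) ->
  forall k, \int[G]_mu (expR (- (mu ^+ 2 / 2)) * (mu ^+ 2) ^+ k) =
            c * \int[H]_mu (expR (- (mu ^+ 2 / 2)) * (mu ^+ 2) ^+ k).
Proof.
move=> GH k.
have coefE P : cosh_coef P 0 (2 * k) =
    2 / (2 * k)`!%:R * \int[P]_mu (expR (- (mu ^+ 2 / 2)) * (mu ^+ 2) ^+ k).
  rewrite /cosh_coef oppr0 -mulrDl mulrAC; congr (_ / _).
  rewrite mulr_natl mulr2n; congr (_ + _); apply: eq_Rintegral => mu _;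
  by rewrite /gauss_tilt mul0r addr0 exprM ?sqrrN.
have : cosh_coef G 0 (2 * k) = c * cosh_coef H 0 (2 * k).
  apply: cosh_coef_eq => e e0; exists (e / 2); last exact: GH.
  by rewrite normr_gt0 gtr0_norm ?divr_gt0//; apply/andP; split; lra.
rewrite !coefE mulrCA => /mulfI; apply.
by rewrite mulf_neq0// invr_neq0// pnatr_eq0 -lt0n fact_gt0.
Qed.

End cosh_transform.

(** * From Gaussian-weighted moments to the Laplace transform of mu^2 *)

Section gaussian_moments.
Context {R : realType}.
Implicit Types (P G H : probability R R) (l c t y mu : R).

Definition gauss_moment P l (j : nat) : R :=
  \int[P]_mu (expR (- (l * mu ^+ 2)) * (mu ^+ 2) ^+ j).

Let measurable_gauss l (j : nat) :
  measurable_fun setT (fun mu : R => expR (- (l * mu ^+ 2)) * (mu ^+ 2) ^+ j).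
Proof.
apply: measurable_funM; last by do 2 apply: measurable_funX.
apply: measurableT_comp => //; apply: measurableT_comp => //.
by apply: measurable_funM => //; exact: measurable_funX.
Qed.

(** With x = (l - r) mu^2, this is x^j <= j! e^x: the spare rate l - r pays for the polynomial
    factor. *)
Let gauss_bound l r (j : nat) mu : r < l ->
  `|expR (- (l * mu ^+ 2)) * (mu ^+ 2) ^+ j| * expR (r * `|mu ^+ 2|)
  <= j`!%:R / (l - r) ^+ j.
Proof.
move=> rl; have lr0 : 0 < l - r by rewrite subr_gt0.
have m0 : 0 <= mu ^+ 2 by exact: sqr_ge0.
have mj0 : 0 <= (mu ^+ 2) ^+ j by exact: exprn_ge0.
rewrite (ger0_norm m0) ger0_norm; last by rewrite mulr_ge0 ?expR_ge0.
rewrite mulrAC -expRD.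
rewrite ler_pdivlMr ?exprn_gt0// -mulrA -exprMn.
have := @exp_coeff_le_expR _ (mu ^+ 2 * (l - r)) j.
rewrite (mulr_ge0 m0 (ltW lr0)) => /(_ isT).
rewrite /exp_coeff/= ler_pdivrMr ?ltr0n ?fact_gt0// => le1.
rewrite (_ : - _ + _ = - (mu ^+ 2 * (l - r))); last by ring.
by rewrite expRN ler_pdivrMl ?expR_gt0// mulrC.
Qed.

Let measurable_sqr : measurable_fun setT (fun mu : R => mu ^+ 2).
Proof. exact: measurable_funX. Qed.

Lemma gauss_moment_series P l t j : 0 < l -> `|t| < l ->
  pseries (fun k => gauss_moment P l (j + k) / k`!%:R) t @ \oo -->
  gauss_moment P (l - t) j.
Proof.
(* The midpoint leaves room on both sides: |t| <= r for the expansion, r < l for the domination. *)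
move=> l0 tl; pose r := (`|t| + l) / 2.
have r0 : 0 < r by rewrite divr_gt0// ltr_wpDl.
have rl : r < l by rewrite /r; lra.
have tr : `|t| <= r by rewrite /r; lra.
have := @expR_moment_series _ _ _ P _ _ _ _ _ (measurable_gauss l j) measurable_sqr r0
  (fun mu => gauss_bound j mu rl) tr.
rewrite (_ : (fun k : nat => _) = (fun k => gauss_moment P l (j + k) / k`!%:R)).
  rewrite (_ : Rintegral _ _ _ = gauss_moment P (l - t) j)//.
  apply: eq_Rintegral => mu _; rewrite mulrAC -expRD; congr (expR _ * _); ring.
apply/funext => k; congr (_ / _); apply: eq_Rintegral => mu _.
by rewrite -mulrA -exprD.
Qed.

(** The endpoint t = l, excluded from [gauss_moment_series], is admissible for j = 0: there e^{-l
    mu^2} e^{l mu^2} = 1 is itself the dominating constant. *)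
Lemma gauss_moment0_series P l : 0 < l ->
  pseries (fun k => gauss_moment P l k / k`!%:R) l @ \oo --> (1 : R).
Proof.
move=> l0.
have ll : `|l| <= l by rewrite gtr0_norm.
have b mu : `|expR (- (l * mu ^+ 2))| * expR (l * `|mu ^+ 2|) <= 1.
  by rewrite !ger0_norm ?expR_ge0 ?(sqr_ge0 mu)// -expRD addNr expR0.
have mg : measurable_fun setT (fun mu : R => expR (- (l * mu ^+ 2))).
  apply: eq_measurable_fun (measurable_gauss l 0) => mu _ /=.
  by rewrite expr0 mulr1.
have := @expR_moment_series _ _ _ P _ _ _ _ _ mg measurable_sqr l0 b ll.
rewrite (_ : Rintegral _ _ _ = 1)//.
rewrite (_ : 1 = \int[P]_mu cst 1 mu); last first.
  by rewrite Rintegral_cst//= mul1r probability_setT.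
by apply: eq_Rintegral => mu _; rewrite -expRD addNr expR0.
Qed.

Variables (G H : probability R R).

Let moments_agree c l := forall j, gauss_moment G l j = c * gauss_moment H l j.

Let pseries_scale c l t j : moments_agree c l ->
  pseries (fun k => gauss_moment G l (j + k) / k`!%:R) t =
  (fun n => c * pseries (fun k => gauss_moment H l (j + k) / k`!%:R) t n).
Proof.
move=> GH; apply/funext => n; rewrite /pseries /series/= mulr_sumr.
by apply: eq_bigr => k _; rewrite GH; ring.
Qed.

(* The expansion of e^{-l mu^2} around l is still dominated at 0, where the
   Laplace transform is the total mass 1 of both laws. *)
Let moments_agree_factor c l : 0 < l -> moments_agree c l -> c = 1.
Proof.
move=> l0 GH.
have := @gauss_moment0_series G l l0.
rewrite (@pseries_scale c l l 0 GH) => lim1.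
have limc : (fun n => c * pseries (fun k => gauss_moment H l (0 + k) / k`!%:R) l n)
    @ \oo --> c * 1 by apply: cvgMr; exact: gauss_moment0_series.
by rewrite -(mulr1 c); exact: (cvg_unique _ limc lim1).
Qed.

(* The expansion around l of the moments at l' only converges for l' < 2 l:
   the positive half-line is reached by iterating. *)
Let moments_agree_step c l l' : 0 < l' -> l' < 2 * l ->
  moments_agree c l -> moments_agree c l'.
Proof.
move=> l'0 l'l GH j.
have tl : `|l - l'| < l by rewrite ltr_norml; apply/andP; split; lra.
have l0 : 0 < l by lra.
have := @gauss_moment_series G l _ j l0 tl; rewrite (pseries_scale _ _ GH) => limG.
have limH : (fun n => c * pseries (fun k => gauss_moment H l (j + k) / k`!%:R) (l - l') n)
    @ \oo --> c * gauss_moment H (l - (l - l')) j.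
  by apply: cvgMr; exact: gauss_moment_series.
have -> : l' = l - (l - l') by ring.
exact: (cvg_unique _ limG limH).
Qed.

Lemma gauss_moments_determine_laplace c l : 0 < l ->
  (forall j, gauss_moment G l j = c * gauss_moment H l j) ->
  forall l', 0 <= l' ->
  \int[G]_mu expR (- (l' * mu ^+ 2)) = \int[H]_mu expR (- (l' * mu ^+ 2)).
Proof.
move=> l0 GH.
have c1 : c = 1 by exact: moments_agree_factor GH.
move: GH; rewrite c1 => {c c1} GH.
have agree n l' : 0 < l' -> l' <= l + n%:R * (l / 2) -> moments_agree 1 l'.
  elim: n l' => [|n IH] l' l'0.
    rewrite mul0r addr0 => l'l; apply: moments_agree_step GH => //; lra.
  have [l'l _|ll'] := leP l' l.
    by apply: moments_agree_step GH => //; lra.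
  rewrite -natr1 mulrDl mul1r => l'n.
  (* The step condition l' < 2 (l' - l / 2) amounts to l < l', hence the case split. *)
  by apply: (@moments_agree_step _ (l' - l / 2)); [|lra|apply: IH; lra].
move=> l'; rewrite le_eqVlt => /predU1P[<-|l'0].
  by apply/eqP; under eq_Rintegral do rewrite mul0r oppr0 expR0;
  under [X in _ == X]eq_Rintegral do rewrite mul0r oppr0 expR0;
  rewrite !Rintegral_cst//= !probability_setT.
have [n ln] : exists n, l' <= l + n%:R * (l / 2).
  exists (Num.truncn (l' / (l / 2))).+1.
  apply: ler_wpDl; first exact: ltW.
  by rewrite -ler_pdivrMr ?divr_gt0// ltW// truncnS_gt.
have := agree n l' l'0 ln 0%N; rewrite mul1r /gauss_moment.
by under eq_Rintegral do rewrite expr0 mulr1;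
  under [X in _ = X]eq_Rintegral do rewrite expr0 mulr1.
Qed.

End gaussian_moments.

(** * Uniqueness for the Laplace transform of mu^2 *)

Section laplace_uniqueness.
Context {R : realType}.
Implicit Types (s t y l a mu : R) (G H : probability R R).

(* With n_i about i e^{i y}, the quantity n_i e^{-i t} tends to 0 when t > y and
   to infinity when t <= y, the factor i settling the boundary case t = y.
   Hence (1 - e^{-i t})^{n_i} tends to the indicator of t > y at every t >= 0. *)
Definition gumbel_exponent y (i : nat) : nat :=
  (Num.truncn (i.+1%:R * expR (i.+1%:R * y))).+1.

Let gumbel y t (i : nat) : R :=
  (1 - expR (- (i.+1%:R * t))) ^+ gumbel_exponent y i.

Lemma bernoulli_ineq (u : R) n : 0 <= u <= 1 -> 1 - n%:R * u <= (1 - u) ^+ n.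
Proof.
move=> /andP[u0 u1]; elim: n => [|n IH]; first by rewrite mul0r subr0 expr0.
have n0 : 0 <= n%:R :> R by [].
have := @ler_wpM2r _ (1 - u) _ _ _ IH; rewrite subr_ge0 u1 => /(_ isT).
rewrite exprSr; apply: le_trans; rewrite -natr1; nra.
Qed.

Lemma expR_ge_sqr (x : R) : 0 <= x -> x ^+ 2 / 2 <= expR x.
Proof. exact: (@exp_coeff_le_expR _ x 2). Qed.

(** With K = k + 1, u = e^{-K t} and n the exponent, Bernoulli's inequality gives 1 - (1 - u)^n <= n
    u. As n <= K e^{K y} + 1, this is at most K e^{-K (t - y)} + e^{-K t}; the two summands are
    bounded through e^x >= x^2 / 2 and e^x >= 1 + x. *)
Let gumbel_gt y t (k : nat) : 0 <= y < t ->
  `|gumbel y t k - 1| <= (2 / (t - y) ^+ 2 + t^-1) * k.+1%:R^-1.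
Proof.
move=> /andP[y0 yt]; rewrite /gumbel.
have t0 : 0 < t by lra.
set K := k.+1%:R : R; have K0 : 0 < K by rewrite ltr0n.
set u := expR (- (K * t)); have u0 : 0 < u by exact: expR_gt0.
have u1 : u <= 1 by rewrite -expR0 ler_expR oppr_le0 mulr_ge0// ltW.
have v1 : (1 - u) ^+ gumbel_exponent y k <= 1.
  by rewrite exprn_ile1 ?subr_ge0// lerBlDr lerDl ltW.
rewrite distrC ger0_norm ?subr_ge0//.
have := @bernoulli_ineq u (gumbel_exponent y k); rewrite (ltW u0) u1 => /(_ isT) v2.
apply: (@le_trans _ _ ((gumbel_exponent y k)%:R * u)); first lra.
have nle : (gumbel_exponent y k)%:R <= K * expR (K * y) + 1 :> R.
  rewrite /gumbel_exponent -natr1 lerD2r truncn_le.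
  by rewrite mulr_ge0 ?expR_ge0// ltW.
apply: (@le_trans _ _ ((K * expR (K * y) + 1) * u)); first by rewrite ler_wpM2r// ltW.
rewrite mulrDl mul1r mulrDl lerD//.
  rewrite /u -mulrA -expRD (_ : _ + _ = - (K * (t - y))); last by ring.
  have s0 : 0 < t - y by rewrite subr_gt0.
  rewrite expRN ler_pdivrMr ?expR_gt0//.
  have := @expR_ge_sqr (K * (t - y)); rewrite mulr_ge0 ?(ltW K0) ?(ltW s0)// => /(_ isT) h.
  have KE : 2 / (t - y) ^+ 2 / K * ((K * (t - y)) ^+ 2 / 2) = K.
    by field; rewrite !gt_eqF.
  rewrite -[leLHS]KE ler_wpM2l//.
  by rewrite ltW// !divr_gt0// exprn_gt0.
rewrite /u expRN -invfM lef_pV2 ?posrE ?expR_gt0 ?mulr_gt0//.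
by rewrite mulrC (le_trans _ (expR_ge1Dx _))// lerDr.
Qed.

(** With the same notation, (1 - u)^n <= e^{-n u}, and n u >= K e^{K (y - t)} >= K; finally e^{-K}
    <= 1 / K. *)
Let gumbel_le y t (k : nat) : 0 <= t <= y -> `|gumbel y t k| <= k.+1%:R^-1.
Proof.
move=> /andP[t0 ty]; rewrite /gumbel.
set K := k.+1%:R : R; have K0 : 0 < K by rewrite ltr0n.
set u := expR (- (K * t)); have u0 : 0 < u by exact: expR_gt0.
have u1 : u <= 1 by rewrite -expR0 ler_expR oppr_le0 mulr_ge0// ltW.
rewrite ger0_norm ?exprn_ge0 ?subr_ge0//.
apply: (@le_trans _ _ (expR (- u) ^+ gumbel_exponent y k)).
  by rewrite ler_pXn2r ?nnegrE ?subr_ge0 ?expR_ge0// expR_ge1Dx.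
rewrite -expRM_natl mulrN expRN lef_pV2 ?posrE ?expR_gt0//.
rewrite (le_trans _ (expR_ge1Dx _))// ler_wpDl//.
have nge : K * expR (K * y) <= (gumbel_exponent y k)%:R.
  by rewrite /gumbel_exponent ltW// truncnS_gt.
apply: (@le_trans _ _ (K * expR (K * y) * u)); last by rewrite ler_wpM2r// ltW.
rewrite -mulrA -expRD ler_peMr ?(ltW K0)// -expR0 ler_expR.
by rewrite -mulrBr mulr_ge0 ?(ltW K0)// subr_ge0.
Qed.

Lemma cvg_gumbel y t : 0 <= y -> 0 <= t ->
  (1 - expR (- (k.+1%:R * t))) ^+ gumbel_exponent y k @[k --> \oo] -->
  ((y < t)%R%:R : R).
Proof.
move=> y0 t0.
have squeeze (C l : R) : (forall k : nat, `|gumbel y t k - l| <= C * k.+1%:R^-1) ->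
    gumbel y t k @[k --> \oo] --> l.
  move=> h; apply/subr_cvg0; apply/norm_cvg0P.
  apply: (@squeeze_cvgr _ _ _ _ (cst 0) (fun k => C * harmonic k)).
  - by apply: nearW => k; rewrite normr_ge0 h.
  - exact: cvg_cst.
  - by rewrite -(mulr0 C); apply: cvgMr; exact: cvg_harmonic.
have [yt|ty] := ltP y t.
  by apply: squeeze => k; apply: gumbel_gt; rewrite y0.
by apply: (squeeze 1) => k; rewrite subr0 mul1r; apply: gumbel_le; rewrite t0.
Qed.


(** Expanding one factor 1 - e^{-k mu^2} turns the integral at rate l into the difference of those
    at rates l and l + k; hence the induction on n keeps l general. *)
Let laplace_mul_gumbel G H :
  (forall l : R, 0 <= l ->
     \int[G]_mu expR (- (l * mu ^+ 2)) = \int[H]_mu expR (- (l * mu ^+ 2))) ->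
  forall n (k l : R), 0 <= k -> 0 <= l ->
  \int[G]_mu (expR (- (l * mu ^+ 2)) * (1 - expR (- (k * mu ^+ 2))) ^+ n) =
  \int[H]_mu (expR (- (l * mu ^+ 2)) * (1 - expR (- (k * mu ^+ 2))) ^+ n).
Proof.
move=> GH n k l k0; elim: n l => [|n IH] l l0.
  under eq_Rintegral do rewrite expr0 mulr1.
  by under [RHS]eq_Rintegral do rewrite expr0 mulr1; exact: GH.
pose f (l : R) (n : nat) (mu : R) := expR (- (l * mu ^+ 2)) * (1 - expR (- (k * mu ^+ 2))) ^+ n.
have m_expR a : measurable_fun setT (fun mu : R => expR (- (a * mu ^+ 2))).
  apply: measurableT_comp => //; apply: measurableT_comp => //.
  by apply: measurable_funM => //; exact: measurable_funX.
have expR01 (a mu : R) : 0 <= a -> 0 <= expR (- (a * mu ^+ 2)) <= 1.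
  by move=> a0; rewrite expR_ge0 -expR0 ler_expR oppr_le0 mulr_ge0// sqr_ge0.
have fi (P : probability R R) (a : R) : 0 <= a -> P.-integrable setT (EFin \o f a n).
  move=> a0; apply: (@bounded_integrable _ _ _ _ _ 1).
    apply: measurable_funM => //; apply: measurable_funX.
    exact: measurable_funB.
  move=> mu; rewrite /f normrM normrX.
  have /andP[u0 u1] := expR01 k mu k0; have /andP[v0 v1] := expR01 a mu a0.
  rewrite (ger0_norm v0) ger0_norm ?subr_ge0// mulr_ile1 ?exprn_ge0 ?subr_ge0//.
  by rewrite exprn_ile1 ?subr_ge0// lerBlDr lerDl.
have recE (P : probability R R) :
    \int[P]_mu f l n.+1 mu = \int[P]_mu f l n mu - \int[P]_mu f (l + k) n mu.
  rewrite -RintegralB//; [|exact: fi|by apply: fi; rewrite addr_ge0].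
  apply: eq_Rintegral => mu _; rewrite /f (exprS _ n).
  rewrite (_ : - ((l + k) * mu ^+ 2) = - (l * mu ^+ 2) + - (k * mu ^+ 2)); last by ring.
  rewrite expRD; ring.
by rewrite -[LHS]/(\int[G]_mu f l n.+1 mu) -[RHS]/(\int[H]_mu f l n.+1 mu)
  !recE /f !IH// addr_ge0.
Qed.

Let measurable_sqr_gt y : measurable [set mu | y < mu ^+ 2].
Proof.
have mf : measurable_fun setT (fun mu : R => mu ^+ 2) by exact: measurable_funX.
have := mf measurableT `]y, +oo[%classic (measurable_itv _).
rewrite setTI; congr measurable; apply/seteqP.
by split => mu /=; rewrite in_itv/= andbT.
Qed.

Let Rintegral_indic_fun (P : probability R R) (y : R) :
  \int[P]_mu ((y < mu ^+ 2)%R%:R : R) = fine (P [set mu | y < mu ^+ 2]).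
Proof.
have mA := measurable_sqr_gt y.
rewrite /Rintegral; congr fine.
have -> : P [set mu | y < mu ^+ 2] = (\int[P]_mu (\1_[set mu | (y < mu ^+ 2)%R] mu)%:E)%E.
  by rewrite integral_indic// setIT.
by apply: eq_integral => mu _; rewrite indicE mem_setE.
Qed.

(** The functions of [cvg_gumbel] at t = mu^2 are bounded by 1 and have equal expectations under G
    and H; dominated convergence passes to the indicator of y < mu^2. *)
Lemma laplace_sqr_tail G H :
  (forall l : R, 0 <= l ->
     \int[G]_mu expR (- (l * mu ^+ 2)) = \int[H]_mu expR (- (l * mu ^+ 2))) ->
  forall y, 0 <= y -> G [set mu | y < mu ^+ 2] = H [set mu | y < mu ^+ 2].
Proof.
move=> GH y y0.
pose f (k : nat) (mu : R) := (1 - expR (- (k.+1%:R * mu ^+ 2))) ^+ gumbel_exponent y k : R.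
have f_cvg (P : probability R R) : \int[P]_mu f k mu @[k --> \oo] -->
    fine (P [set mu | y < mu ^+ 2]).
  rewrite -Rintegral_indic_fun; apply: (@bounded_Rintegral_cvg _ _ _ _ _ _ 1).
  - move=> k; apply: measurable_funX; apply: measurable_funB => //.
    apply: measurableT_comp => //; apply: measurableT_comp => //.
    by apply: measurable_funM => //; exact: measurable_funX.
  - rewrite (_ : (fun mu : R => _) = \1_[set mu | y < mu ^+ 2]).
      apply: measurable_indic; exact: measurable_sqr_gt.
    by apply/funext => mu; rewrite indicE mem_setE.
  - move=> k mu; rewrite /f normrX exprn_ile1//.
    have : 0 <= k.+1%:R * mu ^+ 2 by rewrite mulr_ge0// sqr_ge0.
    rewrite -oppr_le0 -ler_expR expR0 => u1.
    by rewrite ger0_norm ?subr_ge0// lerBlDr lerDl expR_ge0.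
  - by move=> mu; apply: cvg_gumbel => //; exact: sqr_ge0.
have fGH : (fun k => \int[G]_mu f k mu) = (fun k => \int[H]_mu f k mu).
  apply/funext => k.
  have := laplace_mul_gumbel GH (gumbel_exponent y k) (ler0n _ k.+1) (lexx 0).
  under eq_Rintegral do rewrite mul0r oppr0 expR0 mul1r.
  by under [in X in _ = X -> _]eq_Rintegral do rewrite mul0r oppr0 expR0 mul1r.
have := f_cvg G; rewrite fGH => cG.
have GHy : fine (G [set mu | y < mu ^+ 2]) = fine (H [set mu | y < mu ^+ 2]).
  exact: (cvg_unique _ cG (f_cvg H)).
rewrite -[LHS]fineK; last by (apply: fin_num_measure; exact: measurable_sqr_gt).
by rewrite GHy fineK//; (apply: fin_num_measure; exact: measurable_sqr_gt).
Qed.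

(** Open rays are stable under intersection and generate the Borel sets, and the rays from -n
    exhaust the line with finite mass. *)
Lemma probability_eq_ray (P Q : probability R R) :
  (forall x, P `]x, +oo[%classic = Q `]x, +oo[%classic) ->
  forall A, measurable A -> P A = Q A.
Proof.
move=> PQ; apply: (@measure_unique _ _ _ (RGenOInfty.G (R:=R))
  (fun n : nat => `](- n%:R : R), +oo[%classic)).
- exact: RGenOInfty.measurableE.
- move=> _ _ [x ->] [y ->]; exists (Num.max x y); apply/seteqP; split => z/=;
  rewrite !in_itv/= !andbT gt_max; first by case=> -> ->.
  by move=> /andP[xz yz]; split.
- by move=> n; exists (- n%:R).
- apply/seteqP; split => // x _; exists (Num.truncn `|x|).+1 => //=.
  rewrite in_itv/= andbT ltrNl (le_lt_trans _ (truncnS_gt _))//.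
  by rewrite -normrN ler_norm.
- by move=> _ [x ->]; exact: PQ.
- by move=> n; rewrite -ge0_fin_numE//; exact: fin_num_measure.
Qed.

Lemma laplace_determines_Fold G H :
  (forall l, 0 <= l ->
     \int[G]_mu expR (- (l * mu ^+ 2)) = \int[H]_mu expR (- (l * mu ^+ 2))) ->
  forall A, measurable A -> Fold G A = Fold H A.
Proof.
move=> GH.
have mnorm : measurable_fun setT (fun x : R => `|x|) by exact: measurableT_comp.
(* [Fold G] is the pushforward of G by the absolute value; in this form it is a probability, so
   comparing rays suffices. *)
pose N : {mfun R >-> R} := mfun_Sub (mem_set mnorm).
apply: (@probability_eq_ray (distribution G N) (distribution H N)) => x.
rewrite -[LHS]/(G ((fun mu : R => `|mu|) @^-1` `]x, +oo[))
  -[RHS]/(H ((fun mu : R => `|mu|) @^-1` `]x, +oo[)).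
have [x0|x0] := leP 0 x.
  have -> : (fun mu : R => `|mu|) @^-1` `]x, +oo[ = [set mu | x ^+ 2 < mu ^+ 2].
    apply/seteqP; split => mu /=; rewrite in_itv/= andbT => h.
      by rewrite -(real_normK (num_real mu)) ltr_pXn2r// nnegrE.
    by move: h; rewrite -(real_normK (num_real mu)) ltr_pXn2r// nnegrE.
  by apply: laplace_sqr_tail => //; exact: sqr_ge0.
have -> : (fun mu : R => `|mu|) @^-1` `]x, +oo[ = setT.
  by apply/seteqP; split => // mu _ /=; rewrite in_itv/= andbT (lt_le_trans x0).
by rewrite !probability_setT.
Qed.

End laplace_uniqueness.

(** * The density of |Z| and its factorization *)

Section folded_model.
Context {R : realType}.
Implicit Types (P G H : probability R R) (pi q : R -> R) (A S : set R).
Local Notation leb := (@lebesgue_measure R).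

(** The weight w: the standard normal density on the whole line. *)
Definition half_gauss (z : R) : R := normal_peak 1 * expR (- (z ^+ 2 / 2)).

Definition abs_pdf P (z : R) : R := \int[P]_mu folded_normal_pdf mu z.

Lemma half_gauss_gt0 z : 0 < half_gauss z.
Proof. by rewrite mulr_gt0 ?expR_gt0// normal_peak_gt0// oner_neq0. Qed.

Lemma folded_normal_pdfE mu z :
  folded_normal_pdf mu z = half_gauss z * cosh_kernel z mu.
Proof.
rewrite /folded_normal_pdf !normal_pdfE ?oner_neq0// /normal_fun.
rewrite /half_gauss /cosh_kernel -mulrDr -mulrA; congr (_ * _).
rewrite mulrA -expRD mulrDr -!expRD; congr (expR _ + expR _); by field.
Qed.

Lemma folded_normal_pdf_ge0 (mu z : R) : 0 <= folded_normal_pdf mu z.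
Proof. by rewrite addr_ge0// normal_pdf_ge0. Qed.

Lemma measurable_folded_normal_pdf :
  measurable_fun setT (fun x : R * R => folded_normal_pdf x.1 x.2).
Proof.
rewrite (_ : (fun x => _) = fun x => half_gauss x.2 * cosh_kernel x.2 x.1); last first.
  by apply/funext => x; rewrite folded_normal_pdfE.
have mfstsnd : measurable_fun setT (fun x : R * R => x.2 * x.1).
  by apply: measurable_funM.
have msqr (p : R * R -> R) : measurable_fun setT p ->
    measurable_fun setT (fun x => expR (- (p x ^+ 2 / 2))).
  move=> mp; apply: measurableT_comp => //; apply: measurableT_comp => //.
  by apply: measurable_funM => //; exact: measurable_funX.
apply: measurable_funM; first by apply: measurable_funM => //; exact: msqr.
apply: measurable_funM; first exact: msqr.
apply: measurable_funD; apply: measurableT_comp => //.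
exact: measurableT_comp.
Qed.

(** The value is 2 and not 1 because the integral runs over the whole line, where the even density
    of |Z| is counted twice. It serves only as a finite bound. *)
Lemma integral_folded_normal_pdf mu :
  (\int[leb]_z (folded_normal_pdf mu z)%:E = 2%:E)%E.
Proof.
rewrite /folded_normal_pdf.
under eq_integral do rewrite EFinD.
have pdfN z : normal_pdf mu 1 (- z) = normal_pdf (- mu) 1 z :> R.
  by rewrite !normal_pdfE ?oner_neq0// /normal_fun; congr (_ * expR _); field.
under eq_integral do rewrite pdfN.
rewrite ge0_integralD//=; try by [move=> z _; rewrite lee_fin normal_pdf_ge0|
  apply/measurable_EFinP; exact: measurable_normal_pdf].
by rewrite !integral_normal_pdf.
Qed.

(** The weight [q] carries the restriction to a set, being 0 outside it, so the inner integral keeps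
    the whole line as its domain and Tonelli applies directly. *)
Definition folded_mass P q : \bar R :=
  (\int[P]_mu \int[leb]_z (q z * folded_normal_pdf mu z)%:E)%E.

Lemma sel_mass_folded P pi A :
  sel_mass P pi A = folded_mass P (pi \_ (A `&` nonneg)).
Proof.
apply: eq_integral => mu _; rewrite integral_mkcond; apply: eq_integral => z _.
by rewrite /patch; case: ifPn => // _; rewrite mul0r.
Qed.

Section mass.
Variables (P : probability R R) (q : R -> R).
Hypotheses (mq : measurable_fun setT q) (q01 : forall z, 0 <= q z <= 1).

Let joint (x : R * R) : \bar R := (q x.2 * folded_normal_pdf x.1 x.2)%:E.

Let measurable_joint : measurable_fun setT joint.
Proof.
apply/measurable_EFinP; apply: measurable_funM; last first.
  exact: measurable_folded_normal_pdf.
exact: measurableT_comp.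
Qed.

Let joint_ge0 x : (0 <= joint x)%E.
Proof.
by rewrite lee_fin mulr_ge0 ?folded_normal_pdf_ge0//; case/andP: (q01 x.2).
Qed.

Lemma folded_mass_ge0 : (0 <= folded_mass P q)%E.
Proof.
apply: integral_ge0 => mu _; apply: integral_ge0 => z _.
exact: (joint_ge0 (mu, z)).
Qed.

Lemma folded_mass_le2 : (folded_mass P q <= 2%:E)%E.
Proof.
rewrite (_ : 2%:E = \int[P]_mu cst 2%:E mu)%E; last first.
  by rewrite integral_cst//= probability_setT mule1.
apply: ge0_le_integral => //.
- by move=> mu _; apply: integral_ge0 => z _; exact: (joint_ge0 (mu, z)).
- exact: (@measurable_fun_fubini_tonelli_F _ _ _ _ _ leb _ measurable_joint joint_ge0).
- move=> mu _; rewrite /= -(integral_folded_normal_pdf mu).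
  have mpair : measurable_fun setT (fun z : R => (mu, z)) by exact: measurable_pair1.
  apply: ge0_le_integral => //.
  + by move=> z _; exact: (joint_ge0 (mu, z)).
  + exact: measurableT_comp measurable_joint mpair.
  + apply/measurable_EFinP.
    exact: (measurableT_comp measurable_folded_normal_pdf mpair).
  + move=> z _; rewrite lee_fin ler_piMl ?folded_normal_pdf_ge0//.
    by case/andP: (q01 z).
Qed.

Lemma folded_mass_fin_num : folded_mass P q \is a fin_num.
Proof.
by rewrite ge0_fin_numE ?folded_mass_ge0// (le_lt_trans folded_mass_le2)// ltry.
Qed.

Lemma integrable_folded_normal_pdf z :
  P.-integrable setT (EFin \o (folded_normal_pdf ^~ z)).
Proof.
apply: (@bounded_integrable _ _ _ _ _ (normal_peak 1 + normal_peak 1)).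
  have mpair : measurable_fun setT (fun mu : R => (mu, z)) by exact: measurable_pair2.
  exact: (measurableT_comp measurable_folded_normal_pdf mpair).
move=> mu; rewrite ger0_norm ?folded_normal_pdf_ge0//.
by rewrite lerD// normal_pdf_ub// oner_neq0.
Qed.

Lemma folded_mass_abs_pdf :
  (folded_mass P q = \int[leb]_z (q z * abs_pdf P z)%:E)%E.
Proof.
rewrite /folded_mass.
rewrite (@fubini_tonelli _ _ _ _ _ P leb _ measurable_joint joint_ge0).
apply: eq_integral => z _.
have iz := integrable_folded_normal_pdf z.
rewrite -RintegralZl// /Rintegral fineK//.
apply: integrable_fin_num => //.
rewrite [X in P.-integrable _ X](_ : _ =
  (fun mu => (q z)%:E * (EFin \o (folded_normal_pdf ^~ z)) mu)%E)//.
exact: integrableZl.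
Qed.

End mass.

Lemma abs_pdfE P z : abs_pdf P z = half_gauss z * cosh_transform P z.
Proof.
have iz := integrable_folded_normal_pdf P z.
have w0 : half_gauss z != 0 by rewrite gt_eqF// half_gauss_gt0.
have -> : cosh_transform P z = (half_gauss z)^-1 * abs_pdf P z.
  rewrite -RintegralZl//; apply: eq_Rintegral => mu _.
  by rewrite folded_normal_pdfE mulKf.
by rewrite mulVKf.
Qed.

Lemma abs_pdf_ge0 P z : 0 <= abs_pdf P z.
Proof. by apply: Rintegral_ge0 => mu _; exact: folded_normal_pdf_ge0. Qed.

Lemma measurable_abs_pdf P : measurable_fun setT (abs_pdf P).
Proof.
pose joint (x : R * R) : \bar R := (folded_normal_pdf x.1 x.2)%:E.
have mj : measurable_fun setT joint.
  by apply/measurable_EFinP; exact: measurable_folded_normal_pdf.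
have j0 x : (0 <= joint x)%E by rewrite lee_fin folded_normal_pdf_ge0.
apply/measurable_EFinP.
rewrite (_ : _ \o _ = fubini_G P joint).
  exact: (@measurable_fun_fubini_tonelli_G _ _ _ _ _ P _ mj j0).
apply/funext => z; rewrite /= fineK//; apply: integrable_fin_num => //.
exact: integrable_folded_normal_pdf.
Qed.

Lemma measurable_nonneg : measurable (@nonneg R).
Proof.
rewrite (_ : nonneg = `[0, +oo[%classic); first exact: measurable_itv.
by apply/seteqP; split => z; rewrite /nonneg/= in_itv/= andbT.
Qed.

(** The model constrains [pi] on the half-line only; extension by 0 gives a weight that meets the
    global hypotheses on [q]. *)
Lemma restrict_unit_interval pi A : measurable A ->
  measurable_fun nonneg pi -> (forall z, 0 <= z -> 0 <= pi z <= 1) ->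
  measurable_fun setT (pi \_ (A `&` nonneg)) /\
  forall z, 0 <= (pi \_ (A `&` nonneg)) z <= 1.
Proof.
move=> mA mpi pi01; split.
  apply/(measurable_restrictT _ (measurableI _ _ mA measurable_nonneg)).
  by apply: measurable_funS mpi; [exact: measurable_nonneg|exact: subIsetr].
move=> z; rewrite /patch; case: ifPn => [|_]; last by rewrite lexx ler01.
by rewrite inE => -[_]; exact: pi01.
Qed.

Lemma sel_mass_fin_num P pi A : measurable A ->
  measurable_fun nonneg pi -> (forall z, 0 <= z -> 0 <= pi z <= 1) ->
  sel_mass P pi A \is a fin_num.
Proof.
move=> mA mpi pi01; have [mq q01] := restrict_unit_interval mA mpi pi01.
by rewrite sel_mass_folded; exact: folded_mass_fin_num.
Qed.

Lemma abs_mass_fin_num P A : measurable A -> abs_mass P A \is a fin_num.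
Proof. by move=> mA; apply: sel_mass_fin_num => // z _; rewrite ler01 lexx. Qed.

Lemma abs_mass_integral P A : measurable A -> A `<=` nonneg ->
  (abs_mass P A = \int[leb]_(z in A) (abs_pdf P z)%:E)%E.
Proof.
move=> mA A0; rewrite /abs_mass sel_mass_folded.
have [||mq q01] := @restrict_unit_interval (cst 1) A mA.
- exact: measurable_cst.
- by move=> z _; rewrite ler01 lexx.
rewrite folded_mass_abs_pdf// [RHS]integral_mkcond; apply: eq_integral => z _.
rewrite setIidl// /patch; case: ifPn => _; first by rewrite mul1r.
by rewrite mul0r.
Qed.

End folded_model.

(** * Limit points from positive Lebesgue measure *)

(** Without a limit point, Bolzano-Weierstrass makes every bounded piece of Q finite. Then Q is
    countable, hence measurable and null, and S lies in the union of two null sets. *)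
Lemma limit_point_of_positive_measure (R : realType) (S Q : set R) :
  measurable S -> (0 < (@lebesgue_measure R) S)%E ->
  {ae (@lebesgue_measure R), forall z, S z -> Q z} ->
  exists z0, limit_point Q z0.
Proof.
move=> mS S0 [N [mN N0 SQN]]; apply: contrapT => /forallNP nolim.
have finQ n : finite_set (Q `&` [set z | `|z| <= n%:R]).
  apply: contrapT => infQ.
  have bQ : bounded_set (Q `&` [set z | `|z| <= n%:R]).
    exists n%:R; split; first exact: num_real.
    by move=> M nM z [_ /= zn]; rewrite (le_trans zn)// ltW.
  have [z0 z0Q] := infinite_bounded_limit_point_nonempty infQ bQ.
  apply: (nolim z0) => U /z0Q[y [yz [Qy _] Uy]].
  by exists y.
have cQ : countable Q.
  have -> : Q = \bigcup_n (Q `&` [set z | `|z| <= n%:R]).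
    apply/seteqP; split => [z Qz|z [n _ []]//].
    by exists (Num.truncn `|z|).+1 => //; split => //=; rewrite ltW// truncnS_gt.
  by apply: bigcup_countable => // n _; exact: finite_set_countable.
have mQ : measurable Q by exact: countable_measurable.
have SN : S `<=` Q `|` N.
  move=> z Sz; have [Qz|nQz] := pselect (Q z); [by left|right].
  by apply: SQN => /= /(_ Sz).
suff : ((@lebesgue_measure R) S <= 0)%E by rewrite leNgt S0.
have QN0 : (@lebesgue_measure R) (Q `|` N) = 0%E.
  by rewrite null_set_setU//; exact: countable_lebesgue_measure0.
by rewrite -QN0; apply: le_measure; rewrite ?inE//; exact: measurableU.
Qed.

(** * From the observed law to the transforms *)

Section identification.
Context {R : realType}.
Implicit Types (G H : probability R R) (pi : R -> R) (A S : set R).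
Local Notation leb := (@lebesgue_measure R).

Let fine_sel_neq0 S G pi A : measurable A -> model_assumptions S G pi ->
  (0 < sel_mass G pi A)%E -> fine (sel_mass G pi A) != 0.
Proof.
move=> mA [mpi pi01 _ _ _] A0; rewrite gt_eqF// fine_gt0// A0/=.
have := sel_mass_fin_num G mA mpi pi01.
by rewrite ge0_fin_numE// ltW.
Qed.

Let abs_mass_neq0 S G pi : measurable S -> model_assumptions S G pi ->
  fine (abs_mass G S) != 0.
Proof.
move=> mS mod; have [mpi pi01 _ S0 condE] := mod.
have sS : fine (sel_mass G pi S) != 0 := fine_sel_neq0 mS mod S0.
(* At A = [setT] the left side is 1, whereas a zero mass of S would make the right side 0 / 0, which
   is 0 by convention. *)
have := condE setT measurableT; rewrite setTI (divff sS).
have [->|//] := eqVneq (fine (abs_mass G S)) 0.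
by rewrite mul0r => /eqP; rewrite oner_eq0.
Qed.

(** Conditioning the observed law on S gives the law of |Z| given S and D = 1, which by assumption
    is that of |Z| given S. So G and H share the latter, and c is the ratio of their masses on S. *)
Lemma abs_mass_proportional S G H pi pi' :
  measurable S -> model_assumptions S G pi -> model_assumptions S H pi' ->
  (forall A, measurable A -> obs_law G pi A = obs_law H pi' A) ->
  exists c, forall A, measurable A ->
    fine (abs_mass G (A `&` S)) = c * fine (abs_mass H (A `&` S)).
Proof.
move=> mS modG modH obs; exists (fine (abs_mass G S) / fine (abs_mass H S)) => A mA.
have aG := abs_mass_neq0 mS modG; have aH := abs_mass_neq0 mS modH.
have [_ _ GT GS condG] := modG; have [_ _ HT HS condH] := modH.
have sGT := fine_sel_neq0 measurableT modG GT.
have sHT := fine_sel_neq0 measurableT modH HT.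
have sGS := fine_sel_neq0 mS modG GS.
have sHS := fine_sel_neq0 mS modH HS.
have := obs _ mS; have := obs _ (measurableI _ _ mA mS); rewrite /obs_law.
move: (condG _ mA) (condH _ mA).
move: (fine (sel_mass G pi (A `&` S))) (fine (sel_mass G pi S))
  (fine (sel_mass G pi setT)) (fine (sel_mass H pi' (A `&` S)))
  (fine (sel_mass H pi' S)) (fine (sel_mass H pi' setT)) sGT sHT sGS sHS.
move: (fine (abs_mass G S)) (fine (abs_mass H S)) aG aH.
move: (fine (abs_mass G (A `&` S))) (fine (abs_mass H (A `&` S))).
move=> xG xH aG aH aG0 aH0 gA gS gT hA hS hT gT0 hT0 gS0 hS0 eG eH eA eS.
(* The observed laws at A within S and at S have the same normalization P(D = 1), which cancels in
   their ratio. *)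
have eGH : gA / gS = hA / hS.
  have -> : gA / gS = (gA / gT) / (gS / gT) by field; rewrite gS0 gT0.
  by rewrite eA eS; field; rewrite hS0 hT0.
have xE : xG / aG = xH / aH by rewrite -eG -eH.
have -> : xG = xG / aG * aG by rewrite divfK.
by rewrite xE; field.
Qed.

(** Integrable densities with equal integrals over all measurable subsets of S agree almost
    everywhere on S, and the common positive factor [half_gauss] cancels. *)
Lemma cosh_transform_proportional_ae S G H c : measurable S -> S `<=` nonneg ->
  (forall A, measurable A ->
    fine (abs_mass G (A `&` S)) = c * fine (abs_mass H (A `&` S))) ->
  {ae leb, forall z, S z -> cosh_transform G z = c * cosh_transform H z}.
Proof.
move=> mS S0 GH.
have intP (P : probability R R) A : measurable A -> A `<=` S ->
    leb.-integrable A (fun z => (abs_pdf P z)%:E).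
  move=> mA AS; have A0 : A `<=` nonneg by exact: subset_trans AS S0.
  apply/integrableP; split.
    by apply/measurable_EFinP; apply: measurable_funTS; exact: measurable_abs_pdf.
  under eq_integral do rewrite gee0_abs ?lee_fin ?abs_pdf_ge0//.
  by rewrite -abs_mass_integral// -ge0_fin_numE ?abs_mass_fin_num// abs_mass_integral//
    integral_ge0// => z _; rewrite lee_fin abs_pdf_ge0.
have intH : leb.-integrable S (fun z => c%:E * (abs_pdf H z)%:E)%E.
  by apply: integrableZl => //; exact: intP.
have : ae_eq leb S (fun z => (abs_pdf G z)%:E) (fun z => c%:E * (abs_pdf H z)%:E)%E.
  apply: integral_ae_eq => //; first exact: intP.
    exact: (measurable_int leb).
  move=> E ES mE; have E0 : E `<=` nonneg by exact: subset_trans ES S0.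
  rewrite integralZl//; last exact: intP.
  rewrite -!abs_mass_integral//.
  have := GH _ mE; rewrite (setIidl ES) => GHE.
  by rewrite -[LHS]fineK ?abs_mass_fin_num// GHE EFinM fineK// abs_mass_fin_num.
apply: filterS => z /[apply] /eqP; rewrite -EFinM eqe !abs_pdfE mulrCA => /eqP.
by apply: mulfI; rewrite gt_eqF// half_gauss_gt0.
Qed.

End identification.

Theorem theorem1 (R : realType) (S : set R)
  (mS : measurable S) (S_ge0 : S `<=` nonneg)
  (S_pos : (0 < (@lebesgue_measure R) S)%E)
  (G H : probability R R) (pi pi' : R -> R) :
  model_assumptions S G pi -> model_assumptions S H pi' ->
  (forall A, measurable A -> obs_law G pi A = obs_law H pi' A) ->
  forall A, measurable A -> Fold G A = Fold H A.
Proof.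
move=> modG modH obs; apply: laplace_determines_Fold.
have [c massGH] := abs_mass_proportional mS modG modH obs.
have GH_ae := cosh_transform_proportional_ae mS S_ge0 massGH.
have [z0 z0lim] := limit_point_of_positive_measure mS S_pos GH_ae.
(* The point [z0] is a limit point of the agreement set itself, so the agreement hypothesis is the
   identity. *)
have GH := cosh_transform_ext z0lim (fun z => id).
(* The starting rate 1/2 is that of the factor e^{-mu^2/2} in [cosh_kernel]. *)
apply: (@gauss_moments_determine_laplace _ G H c 2^-1) => [|j].
  by rewrite invr_gt0.
have momentE (P : probability R R) : gauss_moment P 2^-1 j =
    \int[P]_mu (expR (- (mu ^+ 2 / 2)) * (mu ^+ 2) ^+ j).
  by apply: eq_Rintegral => mu _; rewrite [2^-1 * _]mulrC.
by rewrite !momentE; exact: cosh_transform_moments.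
Qed.
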